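(* Let $k$ be an algebraically closed field of characteristic $0$, $R=k[x,y]$, $\mathfrak m=(x,y)$, and let $L$ be a generic lex-segment ideal of $R$. Then $\operatorname{depth}\operatorname{gr}_L(R)>0$.
   Context: A lex-segment ideal is a monomial ideal $L$ such that whenever $n,m$ are monomials of the same degree with $n>m$ in the lexicographic order (with $x>y$), $m\in L$ implies $n\in L$. For a homogeneous ideal $I$, $\operatorname{Lex}(I)$ is the unique lex-segment ideal with $\dim_k I_s=\dim_k\operatorname{Lex}(I)_s$ for all $s$. An ideal is generic if it is generated by generic forms (i.e. forms with coefficients in a suitable nonempty Zariski-open set) of given degrees $d_1,\dots,d_r$, $r\ge2$, so that it is $\mathfrak m$-primary; a lex-segment ideal $L$ is generic if $L=\operatorname{Lex}(I)$ for such a generic $\mathfrak m$-primary ideal $I$. $\operatorname{gr}_L(R)=\bigoplus_{n\ge0}L^n/L^{n+1}$. *)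

(* Defs.v *)
From HB Require Import structures.
From mathcomp Require Import all_boot all_order all_algebra.
From mathcomp Require Import mpoly.
Set Implicit Arguments. Unset Strict Implicit. Unset Printing Implicit Defensive.
Import Order.TTheory GRing.Theory.
Local Open Scope ring_scope.

Section Defs.
Variable k : fieldType.

(* R = k[x,y] = {mpoly k[2]}, with x = 'X_0, y = 'X_1. *)
Definition poly2 := {mpoly k[2]}.

Definition mon (a b : nat) : 'X_{1..2} :=
  [multinom (if val i == 0%N then a else b) | i < 2].

Definition ideal_gen (r : nat) (f : 'I_r -> poly2) : poly2 -> Prop :=
  fun p => exists a : 'I_r -> poly2, p = \sum_(i < r) a i * f i.

Fixpoint ideal_pow (P : poly2 -> Prop) (n : nat) : poly2 -> Prop :=
  match n with
  | 0%N => fun _ => True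
  | n'.+1 => fun p => exists s : seq (poly2 * poly2),
        (forall q, q \in s -> ideal_pow P n' q.1 /\ P q.2) /\
        p = \sum_(q <- s) q.1 * q.2
  end.

Definition coefvec (s : nat) (p : poly2) : 'rV[k]_(s.+1) :=
  \row_(j < s.+1) p@_(mon j (s - j)).

(* dim_k P_s = t : the degree-s homogeneous component of P has a basis of
   t elements (row-free matrix whose rows are coefficient vectors of
   elements of P_s and whose row space contains every element of P_s). *)
Definition hdim (P : poly2 -> Prop) (s t : nat) : Prop :=
  exists B : 'M[k]_(t, s.+1),
    [/\ row_free B,
        (forall i : 'I_t, exists p, [/\ P p, p \is s.-homog & coefvec s p = row i B]) &
        (forall p, P p -> p \is s.-homog -> (coefvec s p <= B)%MS)].

(* A monomial ideal of k[x,y] given by its set S of monomials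
   (S a b  <->  x^a y^b in L), closed under multiplication by x and y.
   The ideal consists of the polynomials all of whose monomials are in S. *)
Definition monideal (S : nat -> nat -> bool) : poly2 -> Prop :=
  fun p => all (fun m : 'X_{1..2} => S (m ord0) (m (lift ord0 ord0))) (msupp p).

Definition is_monomial_set (S : nat -> nat -> bool) : Prop :=
  forall a b, S a b -> S a.+1 b /\ S a b.+1.

(* lex-segment (x > y): among monomials of the same degree, x^a' y^b' >lex x^a y^b
   iff a' > a; if the smaller one lies in L so does the larger one. *)
Definition is_lexsegment (S : nat -> nat -> bool) : Prop :=
  is_monomial_set S /\
  forall a b a' b', (a + b = a' + b')%N -> (a < a')%N -> S a b -> S a' b'.

Definition is_Lex_of (I : poly2 -> Prop) (S : nat -> nat -> bool) : Prop :=
  is_lexsegment S /\ forall s, exists t, hdim I s t /\ hdim (monideal S) s t.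

(* Elements of gr_L(R) = (+)_n L^n/L^(n+1), represented by families g
   with g n in L^n and g n = 0 for n large. *)
Definition gr_elt (L : poly2 -> Prop) (g : nat -> poly2) : Prop :=
  (forall n, ideal_pow L n (g n)) /\ exists N, forall n, (N <= n)%N -> g n = 0.

Definition gr_zero (L : poly2 -> Prop) (g : nat -> poly2) : Prop :=
  forall n, ideal_pow L n.+1 (g n).

Definition gr_mul (g h : nat -> poly2) : nat -> poly2 :=
  fun n => \sum_(i < n.+1) g i * h (n - i)%N.

(* the homogeneous maximal ideal M = m/L (+) gr_+ : degree-0 component in
   m = (x,y), i.e. zero constant term *)
Definition gr_in_max (g : nat -> poly2) : Prop := (g 0%N)@_(mon 0 0) = 0.

Definition gr_depth_pos (L : poly2 -> Prop) : Prop :=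
  exists z, [/\ gr_elt L z, gr_in_max z &
    forall w, gr_elt L w -> gr_zero L (gr_mul z w) -> gr_zero L w].

Definition coef_idx (r : nat) (d : 'I_r -> nat) : finType :=
  {i : 'I_r & 'I_(d i).+1}.

(* f_i = sum_(j <= d_i) c_(i,j) x^j y^(d_i - j), with coefficients read
   from a point v of the affine coefficient space k^#|coef_idx| *)
Definition gen_form (r : nat) (d : 'I_r -> nat)
    (v : 'I_#|coef_idx d| -> k) (i : 'I_r) : poly2 :=
  \sum_(j < (d i).+1)
     v (enum_rank (Tagged (fun i0 => 'I_(d i0).+1) j : coef_idx d))
       *: 'X_[mon j (d i - j)].

End Defs.

(* Main.v *)
Require Import Defs.
From HB Require Import structures.
From mathcomp Require Import all_boot all_order all_algebra.
From mathcomp Require Import zify.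
From mathcomp Require Import mpoly.
Set Implicit Arguments.
Unset Strict Implicit.
Unset Printing Implicit Defensive.
Import GRing.Theory.
Local Open Scope ring_scope.

(* For generic forms the Macaulay matrix in degree s has maximal rank, since
   suitable monomials already achieve this. So L_s is spanned by the x^a y^(s-a)
   with a >= l(s), where l(s) = max(0, s + 1 - sum_i max(0, s + 1 - d_i)).
   Let d be the initial degree of L and e the least degree with l(e) = 0; then
   l is concave on [d, e - 1]. The monomial x^a y^b lies in L^n iff there are
   s_1, ..., s_n >= d with sum s_i <= a + b and sum l(s_i) <= a.
   Put u = y^e and v = x^(l d) y^(d - l d). If m u is in L^(n+2), then either m is in
   L^(n+1) (when some s_i >= e), or deg m + e <= (n + 2)(e - 1). If m v is in L^(n+2),
   spreading the s_i apart by concavity shows that either m is in L^(n+1) (when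
   some s_i = d), or deg m >= (n + 1)(e - 1) + 1. As these degree bounds exclude
   each other, comparing the terms of highest and of lowest degree of p shows
   that (u + v) p in L^(n+2) forces p in L^(n+1), i.e. the class of u + v in L/L^2
   is regular on gr_L(R). *)

(** [a] is the x-exponent and [s] the degree of a monomial, the entries of [t] are the degrees of
    its [n] factors in L; the inequalities leave room for a further cofactor. *)
Definition power_point (l : nat -> nat) (d n a s : nat) : Prop :=
  exists t : seq nat, [/\ size t = n, all (leq d) t, (sumn t <= s)%N
                        & (sumn (map l t) <= a)%N].

(** * Sums of [l] over sequences of degrees *)

Section PowerPoints.
Local Open Scope nat_scope.
Variables (l : nat -> nat) (d e : nat).
Hypothesis l_concave : forall x y k, d + k <= x -> x <= y -> y + k < e ->
  l (x - k) + l (y + k) <= l x + l y.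

Lemma sumn_geq c t : all (leq c) t -> size t * c <= sumn t.
Proof. by elim: t => //= x t IH /andP[cx /IH]; lia. Qed.

Lemma sumn_leq c t : ~~ has (leq c) t -> sumn t <= size t * c.-1.
Proof. by elim: t => //= x t IH; rewrite negb_or -ltnNge => /andP[cx /IH]; lia. Qed.

Lemma power_pointS n a s t x :
  size t = n.+1 -> all (leq d) t -> x \in t -> sumn t <= s + x ->
  sumn (map l t) <= a + l x -> power_point l d n a s.
Proof.
move=> st dt xt ts ta; have pt := perm_to_rem xt; exists (rem x t); split.
- by rewrite size_rem // st.
- by apply/allP => y /mem_rem; apply/allP.
- by move: (perm_sumn pt) => /=; lia.
- by move: (perm_sumn (perm_map l pt)) => /=; lia.
Qed.

(* Two entries strictly between d and e - 1 can be moved apart, without increasing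
   the sum of the l(s_i), until one of them reaches d or e - 1. *)
Lemma spread_extremal n t : size t = n.+1 -> all (leq d) t ->
  exists x t', [/\ size t' = n, d <= x, all (leq d) t',
    x + sumn t' = sumn t /\ l x + sumn (map l t') <= sumn (map l t)
    & x = d \/ all (leq e.-1) t'].
Proof.
elim: n t => [|n IH] [|x t] //=.
  case: t => //= _; rewrite andbT => dx; exists x, [::] => /=.
  by split=> //; right.
case=> /IH{}IH /andP[dx /IH[y [t' [st dy dt [ets lts] h]]]].
case: (eqVneq y d) => [yd|ynd].
  exists d, (x :: t') => /=; rewrite st dx dt; split=> //; last by left.
  by split; [lia|subst y; lia].
case: h => [/eqP|et]; first by rewrite (negPf ynd).
have [ex|xe] := leqP e.-1 x.
  by exists y, (x :: t') => /=; rewrite st dx dt ex et; split=> //; [split; lia|right].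
have [ey|ye] := leqP e.-1 y.
  by exists x, (y :: t') => /=; rewrite st dy dt ey et; split=> //; [split; lia|right].
(* [k] is the largest shift keeping both entries in [d, e - 1], so one of them lands on an end. *)
pose m := minn x y; pose M := maxn x y; pose k := minn (m - d) (e.-1 - M).
have cl : l (m - k) + l (M + k) <= l x + l y.
  have -> : l x + l y = l m + l M.
    by rewrite /m /M; case: (leqP x y) => _ //; apply: addnC.
  by apply: l_concave; rewrite /k /M /m; lia.
have [km|km] : k = m - d \/ k = e.-1 - M by rewrite /k; lia.
- exists (m - k), ((M + k) :: t'); split; rewrite /= ?st ?dt ?andbT //.
  + by rewrite /m /M in km *; lia.
  + by rewrite /m /M in km *; lia.
  + by split; [rewrite /m /M /k; lia|lia].
  + by left; rewrite /m in km *; lia.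
- exists (m - k), ((M + k) :: t'); split; rewrite /= ?st ?dt ?et ?andbT //.
  + by rewrite /k /m; lia.
  + by rewrite /m /M in km *; lia.
  + by split; [rewrite /m /M /k; lia|lia].
  + by right; rewrite /M in km *; lia.
Qed.

Lemma power_point_bottom n a s : power_point l d n.+2 (a + l d) (s + d) ->
  power_point l d n.+1 a s \/ d.+1 + n.+1 * e.-1 <= s + d.
Proof.
case=> t [st dt ts ta].
have [x [t' [st' dx dt' [ets lts]]]] := spread_extremal st dt.
have [xd _|xd] := eqVneq x d.
  by subst x; left; exists t'; split=> //; lia.
case=> [/eqP|et']; first by rewrite (negPf xd).
right; have := sumn_geq et'; rewrite st'; lia.
Qed.

Hypothesis l_mono : forall s s', d <= s -> s <= s' -> l s' <= l s.
Hypothesis l_e : l e = 0.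

(** Enlarging an entry is free since [l] is non-increasing, so the entries may be taken to sum to s
    + e exactly. Then either an entry of at least e is removed, or all are at most e - 1. *)
Lemma power_point_top n a s : power_point l d n.+2 a (s + e) ->
  power_point l d n.+1 a s \/ (d < e /\ s + e <= n.+2 * e.-1).
Proof.
case=> -[|x t] [] //= [st] /andP[dx dt] ts ta.
pose t' := (s + e - sumn t) :: t.
have dt' : all (leq d) t' by rewrite /= dt andbT; lia.
have sum' : sumn t' = s + e by rewrite /=; lia.
have lt' : sumn (map l t') <= a.
  by apply: leq_trans ta; rewrite leq_add2r l_mono //; lia.
have [/hasP[y yt ey]|h] := boolP (has (leq e) t').
  left; apply: (power_pointS (t := t') (x := y)) => //; first by rewrite /= st.
    by rewrite sum' leq_add2l.
  by rewrite (leq_trans lt') ?leq_addr.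
right; split.
  move/hasPn: h => /(_ (s + e - sumn t)); rewrite inE eqxx => /(_ isT).
  by rewrite -ltnNge; apply: leq_ltn_trans; case/andP: dt'.
by have := sumn_leq h; rewrite sum' /= st.
Qed.

End PowerPoints.

(** * Monomials and supports in two variables *)

Lemma mon0 a b : mon a b ord0 = a. Proof. exact: mnmE. Qed.

Lemma mon1 a b : mon a b (lift ord0 ord0) = b. Proof. exact: mnmE. Qed.

Lemma mdeg2 (m : 'X_{1..2}) : mdeg m = (m ord0 + m (lift ord0 ord0))%N.
Proof. by rewrite mdegE big_ord_recl big_ord1. Qed.

Lemma mon_eta (m : 'X_{1..2}) : m = mon (m ord0) (m (lift ord0 ord0)).
Proof.
apply/mnmP => i; rewrite mnmE.
case: i => -[|[|//]] lt_i /=; congr (m _); exact: val_inj.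
Qed.

Lemma monD a b a' b' : (mon a b + mon a' b')%MM = mon (a + a') (b + b').
Proof. by apply/mnmP => i; rewrite mnmDE !mnmE; case: ifP. Qed.

Lemma mon_inj a b a' b' : (mon a b == mon a' b') = (a == a') && (b == b').
Proof.
apply/eqP/andP => [e|[/eqP-> /eqP->]//].
move: (congr1 (fun m : 'X_{1..2} => (m ord0, m (lift ord0 ord0))) e).
by rewrite !mon0 !mon1 => -[-> ->].
Qed.

Lemma mdeg_mon a b : mdeg (mon a b) = (a + b)%N.
Proof. by rewrite mdeg2 mon0 mon1. Qed.

(** A term u m of the product can be cancelled only by some v m'. *)
Lemma msupp_binomM (k : fieldType) (c c' : k) (u v m : 'X_{1..2}) (p : {mpoly k[2]}) :
  c != 0 -> m \in msupp p ->
  (u + m)%MM \in msupp ((c *: 'X_[u] + c' *: 'X_[v]) * p) \/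
  exists m', [/\ m' \in msupp p, (u + m = v + m')%MM & c' != 0].
Proof.
move=> nzc mp; have [|nzh] := boolP (_ \in _); [by left | right].
have nzu : (p * 'X_[u])@_(u + m) != 0 by rewrite mcoeffMX -mcoeff_msupp.
move: nzh; rewrite mcoeff_msupp negbK mulrDl mcoeffD -!scalerAl !mcoeffZ.
rewrite ![_ * p]mulrC => /eqP e0.
have : c' * (p * 'X_[v])@_(u + m) != 0.
  by apply: contra_neq (mulf_neq0 nzc nzu) => z0; rewrite z0 addr0 in e0.
rewrite mulf_eq0 negb_or => /andP[nzc']; rewrite -mcoeff_msupp.
by rewrite (perm_mem (msuppMX _ _)) => /mapP[m' ? ?]; exists m'.
Qed.

(** * Powers of a lex-segment ideal and the regular element *)

Section MonomialPowers.
Variables (k : fieldType) (S : nat -> nat -> bool) (l : nat -> nat) (d e : nat).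
Hypothesis S_l : forall a b, S a b = (l (a + b) <= a)%N.
Hypothesis l_le : forall s, (l s <= s)%N = (d <= s)%N.
Hypothesis l_mono : forall s s', (d <= s)%N -> (s <= s')%N -> (l s' <= l s)%N.
Hypothesis l_e : l e = 0%N.
Hypothesis l_concave : forall x y k, (d + k <= x)%N -> (x <= y)%N ->
  (y + k < e)%N -> (l (x - k) + l (y + k) <= l x + l y)%N.

Let in_pow n (m : 'X_{1..2}) := power_point l d n (m ord0) (mdeg m).

Lemma in_powM n (m m' : 'X_{1..2}) : in_pow n m -> S (m' ord0) (m' (lift ord0 ord0)) ->
  in_pow n.+1 (m + m')%MM.
Proof.
case=> t [st dt ts ta]; rewrite S_l -mdeg2 => lm'.
exists (mdeg m' :: t); rewrite /= st dt mnmDE mdegD -l_le; split=> //; try lia.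
by rewrite andbT (leq_trans lm') // mdeg2 leq_addr.
Qed.

Lemma in_powS_decomp n (m : 'X_{1..2}) : in_pow n.+1 m ->
  exists m1 m2 : 'X_{1..2}, [/\ m = (m1 + m2)%MM, in_pow n m1
                  & S (m2 ord0) (m2 (lift ord0 ord0))].
Proof.
rewrite /in_pow mdeg2; move: (m ord0) (m (lift ord0 ord0)) (mon_eta m) => a b ->.
case=> -[|x t] [] //= [st] /andP[dx dt] ts ta.
have lx : (l x <= x)%N by rewrite l_le.
have lt : (sumn (map l t) <= sumn t)%N.
  elim: t dt {st ts ta} => //= y t IH /andP[dy /IH]; have := l_le y; rewrite dy; lia.
(* The factor split off has degree [x] and the largest x-exponent that leaves enough for [t]. Its
   y-exponent is at most [b] because the sum of the l(t_i) is at most the sum of the t_i. *)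
pose a2 := minn (a - sumn (map l t)) x.
exists (mon (a - a2) (b - (x - a2))), (mon a2 (x - a2)).
rewrite monD mon0 mon1 mon0 mdeg_mon S_l; split.
- by congr mon; rewrite /a2; lia.
- by exists t; split=> //; rewrite /a2; lia.
- by rewrite subnKC ?geq_minr // /a2; lia.
Qed.

Lemma ideal_pow_monideal n (p : {mpoly k[2]}) :
  ideal_pow (@monideal k S) n p <-> forall m, m \in msupp p -> in_pow n m.
Proof.
split.
- elim: n p => [|n IH] p /=; first by move=> _ m _; exists [::].
  case=> s [hs ->] m /msupp_sum_le /flattenP[_ /mapP[q qs ->]].
  rewrite mem_filter /= in qs; case: (hs q qs) => /IH h1 /allP h2.
  by move=> /msuppM_le /allpairsP[[m1 m2] /= [/h1 ? /h2 ? ->]]; apply: in_powM.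
- elim: n p => [//|n IH] p h /=; rewrite (mpolyE p).
  have: {subset msupp p <= msupp p} by [].
  elim: {1 3}(msupp p) => [_|m r IHr sub].
    by exists [::]; split=> //; rewrite !big_nil.
  have [m' m'r|s [hs es]] := IHr; first by apply: sub; rewrite inE m'r orbT.
  have [|m1 [m2 [em h1 h2]]] := @in_powS_decomp n m.
    by apply/h/sub; rewrite inE eqxx.
  exists ((p@_m *: 'X_[m1], 'X_[m2]) :: s); split; last first.
    by rewrite !big_cons es /= -scalerAl -mpolyXD -em.
  move=> q; rewrite inE => /orP[/eqP->|/hs //]; split=> /=.
    by apply: IH => m' /msuppZ_le; rewrite msuppX inE => /eqP->.
  by apply/allP => m'; rewrite msuppX inE => /eqP->.
Qed.

Let u := mon 0 e.
Let v := mon (l d) (d - l d).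
(* If d = e then u = v, and the second term is dropped. *)
Let c : k := (d < e)%:R.

Let l_d : (l d <= d)%N. Proof. by rewrite l_le. Qed.

Let d_le_e : (d <= e)%N. Proof. by rewrite -l_le l_e. Qed.

Let in_powu n m : in_pow n m -> in_pow n.+1 (u + m)%MM.
Proof. by move=> h; rewrite addmC; apply: in_powM; rewrite // S_l mon0 mon1 l_e. Qed.

Let in_powv n m : in_pow n m -> in_pow n.+1 (v + m)%MM.
Proof. by move=> h; rewrite addmC; apply: in_powM; rewrite // S_l mon0 mon1 subnKC. Qed.

Lemma binom_regular n (p : {mpoly k[2]}) :
  (forall m, m \in msupp ((1 *: 'X_[u] + c *: 'X_[v]) * p) -> in_pow n.+2 m) ->
  forall m, m \in msupp p -> in_pow n.+1 m.
Proof.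
move=> hp.
have top (m : 'X_{1..2}) : m \in msupp p ->
    in_pow n.+1 m \/ (d < e /\ mdeg m + e <= n.+2 * e.-1)%N.
  (* Descending induction on the degree: if u m cancels, then u m = v m' with deg m' = deg m + e - d
     > deg m. *)
  have [j] := ubnP (msize p - mdeg m); elim: j m => // j IH m ltj mp.
  have : in_pow n.+2 (u + m)%MM \/ (d < e /\ mdeg m + e <= n.+2 * e.-1)%N.
    have [/hp|[m' [m'p em nzc]]] := msupp_binomM c u v (oner_neq0 k) mp; first by left.
    have de : (d < e)%N by move: nzc; rewrite /c; case: ltnP; rewrite ?eqxx.
    move: (congr1 mdeg em); rewrite !mdegD !mdeg_mon subnKC // add0n => dm.
    have := msize_mdeg_lt m'p => ltm'.
    case: (IH m' _ m'p) => [|/in_powv|[_ ?]]; first by lia.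
      by rewrite -em; left.
    by right; split=> //; lia.
  case=> [|?]; last by right.
  rewrite /in_pow mdegD mdeg_mon add0n mnmDE mon0 add0n [(e + _)%N]addnC.
  exact: power_point_top.
(* Ascending induction: if v m cancels, then v m = u m' with deg m' < deg m. *)
move=> m; have [j] := ubnP (mdeg m); elim: j m => // j IH m ltj mp.
have [//|[de low]] := top m mp.
have nzc : c != 0 by rewrite /c de oner_neq0.
have : in_pow n.+2 (v + m)%MM.
  have [|[m' [m'p em _]]] := msupp_binomM 1 v u nzc mp.
    by rewrite addrC => /hp.
  move: (congr1 mdeg em); rewrite !mdegD !mdeg_mon subnKC // add0n => dm.
  by rewrite em; apply/in_powu/IH => //; lia.
rewrite /in_pow mdegD mdeg_mon subnKC // mnmDE mon0 addnC [(d + _)%N]addnC.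
by case/(power_point_bottom l_concave) => // high; lia.
Qed.

Lemma monideal_gr_depth_pos : gr_depth_pos (@monideal k S).
Proof.
pose z n : {mpoly k[2]} := if n == 1%N then 1 *: 'X_[u] + c *: 'X_[v] else 0.
exists z; split; last 1 first.
- move=> w _ zw n; apply/ideal_pow_monideal; apply: binom_regular.
  (* [z] is concentrated in degree 1, so the component of z w in degree n + 1 involves only [w n],
     and its vanishing means membership in L^(n+2). *)
  suff <- : gr_mul z w n.+1 = (1 *: 'X_[u] + c *: 'X_[v]) * w n.
    by apply/ideal_pow_monideal; apply: zw.
  rewrite /gr_mul !big_ord_recl /= mul0r add0r subSS subn0.
  by rewrite big1 ?addr0 // => i _; rewrite mul0r.
- split=> [n|]; last by exists 2%N => -[|[]].
  apply/ideal_pow_monideal => m; rewrite /z; case: eqP => [->|_]; last first.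
    by rewrite msupp0.
  have p0 : in_pow 0 0%MM by exists [::].
  move=> /msuppD_le; rewrite mem_cat => /orP[] /msuppZ_le; rewrite msuppX inE => /eqP->.
    by rewrite -[u]addm0; apply: in_powu.
  by rewrite -[v]addm0; apply: in_powv.
- by rewrite /gr_in_max /z mcoeff0.
Qed.

End MonomialPowers.

(** * Generic ranks, and dimensions as ranks *)

Lemma generic_rank (k : fieldType) n p q (M : 'M[{mpoly k[n]}]_(p, q)) (v0 : 'I_n -> k) :
  exists F : {mpoly k[n]}, F != 0 /\ forall v, F.@[v] != 0 ->
    (\rank (map_mx (meval v0) M) <= \rank (map_mx (meval v) M))%N.
Proof.
set A := map_mx _ M.
(* [L] and [C] are one-sided inverses of the column and row bases of [A], so [F], a determinant of
   size rank A, takes the value 1 at [v0]. *)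
have /row_fullP[L LA] := col_base_full A.
have /row_freeP[C AC] := row_base_free A.
pose F := \det (map_mx (@mpolyC n k) L *m M *m map_mx (@mpolyC n k) C).
have FE v : F.@[v] = \det (L *m map_mx (meval v) M *m C).
  rewrite -det_map_mx !map_mxM /= -!map_mx_comp; congr (\det (_ *m _ *m _));
    by apply/matrixP => i j; rewrite mxE /= mevalC.
have LAC : L *m A *m C = 1%:M.
  by rewrite -[X in L *m X](mulmx_base A) mulmxA LA mul1mx AC.
exists F; split=> [|v].
  apply: contraTneq (oner_neq0 k) => F0.
  by rewrite -(det1 k (\rank A)) -LAC -FE F0 meval0 eqxx.
rewrite FE => nz; have <- : \rank (L *m map_mx (meval v) M *m C) = \rank A.
  by apply: mxrank_unit; rewrite unitmxE unitfE.
by apply: leq_trans (mxrankM_maxl _ _) (mxrankM_maxr _ _).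
Qed.

(** Serves both ideals: [M] will be a Macaulay matrix for I and a coordinate projector for L. *)
Lemma hdim_rank (k : fieldType) (P : poly2 k -> Prop) s t m (M : 'M[k]_(m, s.+1)) :
  hdim P s t ->
  (forall p, P p -> p \is s.-homog -> (coefvec s p <= M)%MS) ->
  (forall i, exists p, [/\ P p, p \is s.-homog & coefvec s p = row i M]) ->
  t = \rank M.
Proof.
case=> B [/eqP freeB inB spanB] spanM inM; rewrite -freeB; apply/eqP.
rewrite eqn_leq !mxrankS //; apply/row_subP => i.
  by have [p [Pp hp <-]] := inM i; apply: spanB.
by have [p [Pp hp <-]] := inB i; apply: spanM.
Qed.

Lemma coefvec0 (k : fieldType) s : coefvec s (0 : poly2 k) = 0.
Proof. by apply/rowP => j; rewrite !mxE mcoeff0. Qed.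

Lemma coefvecD (k : fieldType) s (p q : poly2 k) :
  coefvec s (p + q) = coefvec s p + coefvec s q.
Proof. by apply/rowP => j; rewrite !mxE mcoeffD. Qed.

Lemma coefvecZ (k : fieldType) s c (p : poly2 k) : coefvec s (c *: p) = c *: coefvec s p.
Proof. by apply/rowP => j; rewrite !mxE mcoeffZ. Qed.

Lemma coefvec_sum_sub (k : fieldType) s (I : Type) (r : seq I) (F : I -> poly2 k)
    m (M : 'M[k]_(m, s.+1)) :
  (forall i, (coefvec s (F i) <= M)%MS) -> (coefvec s (\sum_(i <- r) F i)%R <= M)%MS.
Proof.
move=> h; elim/big_ind: _ => [|p q hp hq|//]; first by rewrite coefvec0 sub0mx.
by rewrite coefvecD addmx_sub.
Qed.

(** * Generic Hilbert function via Macaulay matrices *)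

Section Macaulay.
Variables (k : fieldType) (r : nat) (d : 'I_r -> nat).

Definition shift_idx s : finType := {i : 'I_r & 'I_(s.+1 - d i)}.

(* The row of index (i, q) consists of the coefficients of
   x^q y^(s - d_i - q) f_i, for indeterminate coefficients of f_i. *)
Definition macaulay s : 'M[{mpoly k[#|coef_idx d|]}]_(#|shift_idx s|, s.+1) :=
  \matrix_(p < #|shift_idx s|, j < s.+1)
    \sum_(c < (d (tag (enum_val p))).+1 | (c + tagged (enum_val p) == j)%N)
    'X_(enum_rank (Tagged (fun i => 'I_(d i).+1) c : coef_idx d)).

Lemma card_shift_idx s : #|shift_idx s| = (\sum_i (s.+1 - d i))%N.
Proof.
rewrite card_tagged sumnE big_map big_enum /=.
by apply: eq_bigr => i _; rewrite card_ord.
Qed.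

Lemma gen_form_homog (v : 'I_#|coef_idx d| -> k) i : gen_form v i \is (d i).-homog.
Proof.
by apply: rpred_sum => j _; rewrite dhomogZ // dhomogX /= mdeg_mon subnKC // -ltnS.
Qed.

Lemma coefvec_macaulay (v : 'I_#|coef_idx d| -> k) s (p : 'I_#|shift_idx s|) :
  coefvec s ('X_[mon (tagged (enum_val p)) (s - d (tag (enum_val p)) - tagged (enum_val p))]
             * gen_form v (tag (enum_val p)))
  = row p (map_mx (meval v) (macaulay s)).
Proof.
apply/rowP => j; rewrite !mxE; case: (enum_val p) => i q /=.
rewrite raddf_sum /= mulr_sumr raddf_sum /= [RHS]big_mkcond /=; apply: eq_bigr => c _.
rewrite -scalerAr mcoeffZ -mpolyXD mcoeffX monD mon_inj mevalXU addnC.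
(* Both monomials have degree s, so equal x-exponents force equal y-exponents. *)
have -> : (s - d i - q + (d i - c) == s - j)%N =
    (c + q == j)%N || (c + q != j)%N && (s - d i - q + (d i - c) == s - j)%N.
  by have := ltn_ord q; have := ltn_ord c; have := ltn_ord j; lia.
by case: eqP => _ /=; rewrite ?mulr1 ?mulr0.
Qed.

Lemma hdim_ideal_gen (v : 'I_#|coef_idx d| -> k) s t :
  hdim (ideal_gen (gen_form v)) s t -> t = \rank (map_mx (meval v) (macaulay s)).
Proof.
move=> /hdim_rank; apply.
- move=> p [a ->] _; apply: coefvec_sum_sub => i.
  rewrite (mpolyE (a i)) mulr_suml; apply: coefvec_sum_sub => m.
  rewrite -scalerAl coefvecZ scalemx_sub //.
  (* Only terms of a_i of degree s - d_i reach degree s, and they yield rows of the matrix. *)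
  have [dm|dm] := eqVneq (mdeg m + d i)%N s; last first.
    suff -> : coefvec s ('X_[m] * gen_form v i) = 0 by apply: sub0mx.
    apply/rowP => j; rewrite !mxE.
    have /dhomog_nemf_coeff -> // : 'X_[m] * gen_form v i \is (mdeg m + d i).-homog.
      by apply: dhomogM (gen_form_homog v i); rewrite dhomogX.
    by rewrite /= mdeg_mon subnKC 1?eq_sym // -ltnS.
  have lt_q : (m ord0 < s.+1 - d i)%N by rewrite mdeg2 in dm; lia.
  pose x : shift_idx s := Tagged (fun i => 'I_(s.+1 - d i)) (Ordinal lt_q).
  have := coefvec_macaulay v (enum_rank x); rewrite enum_rankK /=.
  have -> : mon (m ord0) (s - d i - m ord0) = m.
    by rewrite [RHS]mon_eta; congr mon; rewrite mdeg2 in dm; lia.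
  by move=> ->; apply: row_sub.
- move=> p; rewrite -coefvec_macaulay; set i := tag _; set q := tagged _.
  exists ('X_[mon q (s - d i - q)] * gen_form v i); split=> //.
    exists (fun j => if j == i then 'X_[mon q (s - d i - q)] else 0).
    rewrite (bigD1 i) //= eqxx big1 ?addr0 // => j /negPf->; exact: mul0r.
  have /(dhomogM (p := 'X_[mon q (s - d i - q)])) := gen_form_homog v i.
  move=> /(_ (mdeg (mon q (s - d i - q)))); rewrite dhomogX eqxx => /(_ isT).
  suff -> : (mdeg (mon q (s - d i - q)) + d i = s)%N by [].
  by rewrite mdeg_mon; have : (q < s.+1 - d i)%N by []; lia.
Qed.

Lemma partial_sum_cover (n : 'I_r -> nat) j : (j < \sum_i n i)%N ->
  exists i : 'I_r, (\sum_(i' < r | i' < i) n i' <= j < \sum_(i' < r | i' < i) n i' + n i)%N.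
Proof.
pose C m := (\sum_(i' < r | i' < m) n i')%N.
move=> ltj; have exC : exists m, (j < C m)%N.
  exists r; rewrite /C (eq_bigl xpredT) // => i; exact: ltn_ord.
case: (ex_minnP exC) => -[|m]; first by rewrite /C big_pred0.
move=> ltC minC; have leC : (C m <= j)%N.
  by rewrite leqNgt; apply/negP => /minC; rewrite ltnn.
have [ltm|gem] := ltnP m r.
  exists (Ordinal ltm) => /=; rewrite -/(C m) leC /=.
  rewrite /C (bigD1 (Ordinal ltm)) //= addnC in ltC.
  rewrite (eq_bigl (fun i' : 'I_r => i' < m)%N) // in ltC => i.
  by rewrite -val_eqE /=; lia.
suff eC : C m.+1 = C m by rewrite eC ltnNge leC in ltC.
by apply: eq_bigl => i; have := ltn_ord i; lia.
Qed.

(* With n_i = s + 1 - d_i, the monomials f_i = x^(a_i) y^(d_i - a_i) with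
   a_i = min(n_1 + ... + n_(i-1), d_i) have multiples of degree s whose
   x-exponents are consecutive intervals covering [0, min(s + 1, n_1 + ... + n_r)). *)
Lemma macaulay_rank_attained s : exists v : 'I_#|coef_idx d| -> k,
  (minn s.+1 (\sum_i (s.+1 - d i)) <= \rank (map_mx (meval v) (macaulay s)))%N.
Proof.
pose a (i : 'I_r) := minn (\sum_(i' < r | i' < i) (s.+1 - d i'))%N (d i).
pose v (x : 'I_#|coef_idx d|) : k := (val (tagged (enum_val x)) == a (tag (enum_val x)))%:R.
exists v; set rho := minn _ _.
have rho_le : (rho <= s.+1)%N by rewrite geq_minl.
rewrite -(rank_pid_mx k rho_le rho_le); apply/mxrankS/row_subP => j.
have [ltj|gej] := ltnP j rho; last first.
  suff -> : row j (pid_mx rho) = 0 :> 'rV[k]_s.+1 by apply: sub0mx.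
  by apply/rowP => j'; rewrite !mxE ltnNge gej andbF.
have [|i /andP[lei lti]] := @partial_sum_cover (fun i => s.+1 - d i)%N j.
  by apply: leq_trans ltj _; apply: geq_minr.
(* If a_i is cut down to d_i the bound is j <= s, otherwise it is the end of the interval. *)
have lt_q : (j - a i < s.+1 - d i)%N by have := ltn_ord j; rewrite /a; lia.
pose x : shift_idx s := Tagged (fun i => 'I_(s.+1 - d i)) (Ordinal lt_q).
suff -> : row j (pid_mx rho) = row (enum_rank x) (map_mx (meval v) (macaulay s)).
  exact: row_sub.
apply/rowP => j'; rewrite !mxE enum_rankK /= ltj andbT raddf_sum /=.
have lt_a : (a i < (d i).+1)%N by rewrite ltnS geq_minr.
rewrite big_mkcond (bigD1 (Ordinal lt_a)) //= big1 => [|c ca].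
  rewrite mevalXU /v enum_rankK /= eqxx addr0 subnKC; last by rewrite /a; lia.
  by rewrite val_eqE; case: eqP.
case: ifP => // _; rewrite mevalXU /v enum_rankK /=.
by move: ca; rewrite -val_eqE /= => /negPf->.
Qed.

(** The size of the matrix bounds its rank from above; the monomial point gives the same bound from
    below on an open set. *)
Lemma generic_hdim s : exists F : {mpoly k[#|coef_idx d|]}, F != 0 /\
  forall v, F.@[v] != 0 -> forall t, hdim (ideal_gen (gen_form v)) s t ->
    t = minn s.+1 (\sum_i (s.+1 - d i))%N.
Proof.
have [v0 rank_v0] := macaulay_rank_attained s.
have [F [nzF rankF]] := generic_rank (macaulay s) v0.
exists F; split=> // v /rankF rank_v t /hdim_ideal_gen ->; apply/eqP.
rewrite eqn_leq (leq_trans rank_v0 rank_v) andbT leq_min rank_leq_col.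
by rewrite -card_shift_idx rank_leq_row.
Qed.

End Macaulay.

(** * Lex-segment ideals with the generic Hilbert function *)

Lemma hdim_lexsegment (k : fieldType) S s t : is_lexsegment S ->
  hdim (@monideal k S) s t ->
  forall a, (a <= s)%N -> S a (s - a)%N = (s.+1 - t <= a)%N.
Proof.
case=> _ lexS hS.
have [c [lec Sc]] : exists c, (c <= s.+1)%N /\
    forall a, (a <= s)%N -> S a (s - a)%N = (c <= a)%N.
  (* The value c = s + 1 covers the degrees in which L is zero. *)
  have exc : exists c, (s < c)%N || S c (s - c)%N by exists s.+1; rewrite ltnSn.
  case: (ex_minnP exc) => c Sc minc; exists c; split=> [|a lea].
    by apply: minc; rewrite ltnSn.
  apply/idP/idP => [Sa|]; first by apply: minc; rewrite Sa orbT.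
  rewrite leq_eqVlt => /orP[/eqP ca|lt_ca]; first by move: Sc; rewrite ca ltnNge lea.
  move: Sc; rewrite ltnNge (leq_trans (ltnW lt_ca) lea) /= => Sc.
  by apply: lexS Sc; lia.
(* The nonzero rows of this projector are the coefficient vectors of the x^a y^(s-a) with a >= c. *)
suff -> : t = \rank (@copid_mx k s.+1 c) by rewrite rank_copid_mx // subKn.
apply: (hdim_rank hS) => [p /allP Sp hp|i].
- suff -> : coefvec s p = coefvec s p *m copid_mx c by apply: submxMl.
  rewrite mulmxBr mulmx1 [X in _ - X](_ : _ = 0) ?subr0 //.
  apply/rowP => j; rewrite !mxE big1 // => j' _; rewrite !mxE.
  have [/eqP|] := boolP (p@_(mon j' (s - j')) == 0); first by move=> ->; rewrite mul0r.
  rewrite -mcoeff_msupp => /Sp; rewrite mon0 mon1 Sc; last by rewrite -ltnS.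
  by rewrite leqNgt => /negPf->; rewrite andbF mulr0.
- have [lei|gti] := leqP c i; last first.
    exists 0; split; rewrite ?dhomog0 //; first by rewrite /monideal msupp0.
    rewrite coefvec0; apply/rowP => j; rewrite !mxE gti andbT.
    by rewrite subrr.
  exists 'X_[mon i (s - i)]; split.
  + by rewrite /monideal msuppX /= mon0 mon1 Sc ?lei // -ltnS.
  + by rewrite dhomogX /= mdeg_mon subnKC // -ltnS.
  + apply/rowP => j; rewrite !mxE mcoeffX mon_inj (ltnNge i c) lei andbF subr0.
    by rewrite -val_eqE /=; case: eqP => // ->; rewrite eqxx.
Qed.

(** A single [F] can handle only finitely many degrees at once, as a product of nonzero
    polynomials. *)
Lemma generic_hdim_upto (k : fieldType) r (d : 'I_r -> nat) D :
  exists F : {mpoly k[#|coef_idx d|]}, F != 0 /\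
    forall v, F.@[v] != 0 -> forall s t, (s < D)%N ->
      hdim (ideal_gen (gen_form v)) s t -> t = minn s.+1 (\sum_i (s.+1 - d i))%N.
Proof.
elim: D => [|D [F [nzF hF]]]; first by exists 1; split=> //; apply: oner_neq0.
have [G [nzG hG]] := generic_hdim k d D.
exists (F * G); split=> [|v]; first by rewrite mulf_neq0.
rewrite mevalM mulf_eq0 negb_or => /andP[Fv Gv] s t.
rewrite ltnS leq_eqVlt => /orP[/eqP->|]; [exact: hG | exact: hF].
Qed.

(** Two forms suffice: for s >= d_1 + d_2 their summands already add up to at least s + 2. *)
Lemma sum_shift_gt r (d : 'I_r -> nat) : (2 <= r)%N ->
  exists D, forall s, (D <= s)%N -> (s < \sum_i (s.+1 - d i))%N.
Proof.
case: r d => [|[|r]] // d _; exists (d ord0 + d (lift ord0 ord0))%N => s' leDs.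
by rewrite !big_ord_recl; lia.
Qed.

(* For every r >= 2 and degrees d_1..d_r there is a nonempty Zariski-open
   set D(F) (F a nonzero polynomial in the coefficients) such that for
   every choice of coefficients in D(F), with I = (f_1,...,f_r) and
   L = Lex(I), one has depth gr_L(R) > 0. *)
Theorem theorem5p3 (k : closedFieldType) (char0 : [pchar k] =i pred0)
    (r : nat) (hr : (2 <= r)%N) (d : 'I_r -> nat) :
  exists F : {mpoly k[#|coef_idx d|]}, F != 0 /\
    forall v : 'I_#|coef_idx d| -> k, F.@[v] != 0 ->
    forall S : nat -> nat -> bool,
      @is_Lex_of k (ideal_gen (@gen_form k r d v)) S ->
      @gr_depth_pos k (@monideal k S).
Proof.
have [D N_D] := sum_shift_gt d hr.
have [F [nzF hF]] := generic_hdim_upto k d D.+1.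
exists F; split=> // v /hF{}hF S [lexS hS].
have [monoS _] := lexS.
pose N s := (\sum_i (s.+1 - d i))%N; pose l s := (s.+1 - N s)%N.
have S_l a b : S a b = (l (a + b) <= a)%N.
  have S_low a' b' : (a' + b' <= D)%N -> S a' b' = (l (a' + b') <= a')%N.
    move=> leD; have [t [/(hF _ _ leD) et hSt]] := hS (a' + b')%N.
    have := hdim_lexsegment lexS hSt (leq_addr b' a'); rewrite addKn => ->.
    by rewrite et -/(N _) /l; congr (_ <= _)%N; lia.
  have l_high s : (D <= s)%N -> l s = 0%N by move/N_D; rewrite /l /N; lia.
  have S_high i a' b' : (a' + b' = D + i)%N -> S a' b'.
    elim: i a' b' => [|i IH] a' b' eab; first by rewrite S_low ?l_high // eab addn0.
    case: a' eab => [|a'] eab; last by have [|//] := monoS a' b'; apply: IH; lia.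
    case: b' eab => [|b'] eab; first by lia.
    by have [|//] := monoS 0%N b'; apply: IH; lia.
  have [/S_low //|/ltnW leD] := leqP (a + b) D.
  by rewrite l_high // (S_high (a + b - D)%N) // subnKC.
have l_step s : (l s <= s)%N -> (l s.+1 <= l s)%N.
  move=> ls; have : S (l s) (s - l s)%N by rewrite S_l subnKC.
  by case/monoS => _; rewrite S_l addnS subnKC.
have exd : exists s, (l s <= s)%N by exists D; have := N_D D (leqnn D); rewrite /l /N; lia.
have exe : exists s, l s == 0%N by exists D; have := N_D D (leqnn D); rewrite /l /N; lia.
(* [c] is the initial degree of L, since [d] here denotes the degrees of the forms. *)
case: (ex_minnP exd) => c lc minc; case: (ex_minnP exe) => e /eqP le0 mine.
have l_le s : (l s <= s)%N = (c <= s)%N.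
  apply/idP/idP => [/minc //|].
  elim: s => [|s IH]; first by rewrite leqn0 => /eqP <-.
  rewrite leq_eqVlt => /orP[/eqP <- //|/IH ls].
  by rewrite (leq_trans (l_step _ ls)) // (leq_trans ls).
have l_mono s s' : (c <= s)%N -> (s <= s')%N -> (l s' <= l s)%N.
  move=> cs; elim: s' => [|s' IH]; first by rewrite leqn0 => /eqP ->.
  rewrite leq_eqVlt => /orP[/eqP-> //|ss'].
  by rewrite (leq_trans (l_step _ _) (IH ss')) // l_le (leq_trans cs).
apply: (monideal_gr_depth_pos k S_l l_le l_mono le0) => x y j hx xy hy.
(* Each summand max(0, s + 1 - d_i) is convex in s. *)
have N_convex : (N x + N y <= N (x - j) + N (y + j))%N.
  by rewrite /N -!big_split /=; apply: leq_sum => i _; lia.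
(* Below e the truncated subtraction in [l] is exact, so convexity of [N] turns into concavity of
   [l]. *)
have l_pos s : (s < e)%N -> (N s <= s)%N.
  by move=> lts; rewrite leqNgt; apply: contraTN lts => lts; rewrite -leqNgt mine // /l subn_eq0.
have := l_pos _ hy; have := l_pos (x - j)%N; rewrite /l; lia.
Qed.
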